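(* Let $f=\{f_\alpha\}_{\alpha=1}^\infty$ be a sequence of non-negative integers, of which only finitely many are strictly positive. Then the maps $\{h_n\}\mapsto I(\{h_n\})$ and $I\mapsto\{\kappa(I)_n\}$ define mutually inverse isomorphisms between the posets $H_f$ and $J(P_f)$.
   Context: The sequence $f$ records the multiplicities in a countably generated torsion module of bounded order $A=\bigoplus_{\alpha\geq 1}(R/p^\alpha R)^{f_\alpha}$ over a discrete valuation ring $R$ with maximal ideal generated by $p$. The symbol $\infty$ is greater than every integer, and $\infty+1=\infty$. The poset $P_f$: its elements are the pairs $(v,\alpha)$ of integers with $\alpha\geq 1$, $0\leq v<\alpha$ and $f_\alpha>0$; the order is $(v,\alpha)\geq(v',\alpha')$ if and only if $v'\geq v$ and $\alpha'-v'\leq\alpha-v$. $J(P_f)$ is the lattice of order ideals (down-closed subsets, including the empty one) of $P_f$, ordered by inclusion. The poset $H_f$: its elements are the sequences $\{h_n\}_{n\geq 0}=h_0,h_1,\dotsc,h_k,\infty,\infty,\dotsc$ (the constant sequence $\infty,\infty,\dotsc$ being allowed), where $h_0<h_1<\dotsb<h_k$ are non-negative integers such that $f_{h_k+1}>0$ and, whenever $h_n>h_{n-1}+1$ (with $1\leq n\leq k$), $f_{h_{n-1}+1}>0$. The order is $\{h_n\}\leq\{h'_n\}$ if and only if $h_n\geq h'_n$ for all $n\geq 0$. For $\{h_n\}\in H_f$, $I(\{h_n\})$ is the order ideal of $P_f$ generated by $$\{(h_{i-1}-i+1,\,h_{i-1}+1)\mid i\geq 1,\ h_i>h_{i-1}+1\}.$$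 For an order ideal $I\subset P_f$, put $I^0=I$, $I^1=\{(v,\alpha)\in P_f\mid (v-1,\alpha)\in I\}$ and inductively $I^n=(I^{n-1})^1$ for positive integers $n$. The height of an ideal $I$ is $h(I)=\min\{v\mid (v,\alpha)\in I\}$, with the minimum of the empty set being $\infty$. The sequence $\kappa(I)$ is defined by $\kappa(I)_n=h(I^n)$ for all integers $n\geq 0$. *)

(* Defs.v *)
From HB Require Import structures.
From mathcomp Require Export all_boot all_order.
From mathcomp Require Export boolp classical_sets cardinality.
From mathcomp Require Import zify.

Set Implicit Arguments.
Unset Strict Implicit.
Unset Printing Implicit Defensive.

Import Order.TTheory.
Local Open Scope classical_set_scope.

Inductive enat := Fin of nat | Infty.

Definition enat_option (x : enat) : option nat :=
  if x is Fin n then Some n else None.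
Definition option_enat (o : option nat) : enat :=
  if o is Some n then Fin n else Infty.

Lemma enat_optionK : cancel enat_option option_enat.
Proof. by case. Qed.

HB.instance Definition _ := Choice.copy enat (can_type enat_optionK).

Definition le_enat (x y : enat) : bool :=
  match x, y with
  | _, Infty => true
  | Infty, Fin _ => false
  | Fin m, Fin n => (m <= n)%N
  end.

Lemma le_enat_refl : reflexive le_enat.
Proof. by case=> /=. Qed.

Lemma le_enat_anti : antisymmetric le_enat.
Proof. by case=> [m|] [n|] //= /anti_leq ->. Qed.

Lemma le_enat_trans : transitive le_enat.
Proof. by case=> [n|] [m|] [p|] //=; apply: leq_trans. Qed.

HB.instance Definition _ := Order.Le_isPOrder.Build (Order.Disp tt tt) enat
  le_enat_refl le_enat_anti le_enat_trans.

Lemma le_enat_total : total (<=%O : rel enat).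
Proof. by case=> [m|] [n|] //; exact: leq_total. Qed.

HB.instance Definition _ :=
  Order.POrder_isTotal.Build (Order.Disp tt tt) enat le_enat_total.

Definition succ_enat (x : enat) : enat :=
  if x is Fin n then Fin n.+1 else Infty.

(* The minimum, when it exists, is the unique element of A that is a lower
   bound of A; the minimum of the empty set is the default value Infty. *)
Definition min_enat (A : set enat) : enat := xget Infty (A `&` lbound A).

Definition inP (f : nat -> nat) (x : nat * nat) : bool :=
  [&& 1 <= x.2, x.1 < x.2 & 0 < f x.2]%N.

Record P (f : nat -> nat) := MkP { pair_of :> nat * nat; pairP : inP f pair_of }.

HB.instance Definition _ f := [isSub for @pair_of f].
HB.instance Definition _ f := [Choice of P f by <:].

(* The subtractions do not truncate, since x.1 < x.2 for x : P f. *)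
Definition le_P f (x y : P f) : bool :=
  (y.1 <= x.1)%N && (x.2 - x.1 <= y.2 - y.1)%N.

Lemma le_P_refl f : reflexive (@le_P f).
Proof. by move=> x; rewrite /le_P !leqnn. Qed.

Lemma le_P_anti f : antisymmetric (@le_P f).
Proof.
move=> [[v a] /= xP] [[w b] /= yP]; rewrite /le_P /= => le_xy.
apply: val_inj => /=; move: xP yP; rewrite /inP /= => xP yP.
by congr pair; lia.
Qed.

Lemma le_P_trans f : transitive (@le_P f).
Proof. by move=> y x z; rewrite /le_P; lia. Qed.

HB.instance Definition _ f := Order.Le_isPOrder.Build (Order.Disp tt tt) (P f)
  (@le_P_refl f) (@le_P_anti f) (@le_P_trans f).

Definition down_closed d (T : porderType d) (I : set T) : Prop :=
  forall x y : T, (x <= y)%O -> I y -> I x.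

Record J d (T : porderType d) :=
  MkJ { ideal_set :> set T; idealP : `[< down_closed ideal_set >] }.

(* The order on J T is inherited from set T, where <= is inclusion. *)
HB.instance Definition _ d (T : porderType d) := [isSub for @ideal_set d T].
HB.instance Definition _ d (T : porderType d) := [Choice of J T by <:].
HB.instance Definition _ d (T : porderType d) :=
  [SubChoice_isSubPOrder of J T by <: with Order.Disp tt tt].

Lemma down_down_closed d (T : porderType d) (A : set T) :
  `[< down_closed (down A) >].
Proof.
apply/asboolP => x y le_xy [z [Az le_yz]].
by exists z; split=> //; exact: le_trans le_yz.
Qed.

Definition generated_ideal d (T : porderType d) (A : set T) : J T :=
  MkJ (down_down_closed A).

(* A sequence h_0, ..., h_k, oo, oo, ... is given by k and by any a : nat -> nat
   with a n = h_n for n <= k. *)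
Definition inH (f : nat -> nat) (h : nat -> enat) : Prop :=
  (forall n, h n = Infty) \/
  exists (k : nat) (a : nat -> nat),
    [/\ forall n, h n = if (n <= k)%N then Fin (a n) else Infty,
        forall n, (1 <= n <= k)%N -> (a n.-1 < a n)%N,
        (0 < f (a k).+1)%N
      & forall n, (1 <= n <= k)%N -> ((a n.-1).+1 < a n)%N ->
          (0 < f (a n.-1).+1)%N].

Record H (f : nat -> nat) :=
  MkH { seq_of :> nat -> enat; seqP : `[< inH f seq_of >] }.

HB.instance Definition _ f := [isSub for @seq_of f].
HB.instance Definition _ f := [Choice of H f by <:].

Definition le_H f (h h' : H f) : bool := `[< forall n, (h' n <= h n)%O >].

Lemma le_H_refl f : reflexive (@le_H f).
Proof. by move=> h; apply/asboolP => n; exact: lexx. Qed.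

Lemma le_H_anti f : antisymmetric (@le_H f).
Proof.
move=> h h' /andP[/asboolP hh' /asboolP h'h]; apply: val_inj; apply/funext => n.
by apply: le_anti; rewrite hh' h'h.
Qed.

Lemma le_H_trans f : transitive (@le_H f).
Proof.
move=> h' h h'' /asboolP hh' /asboolP h'h''; apply/asboolP => n.
exact: le_trans (hh' n).
Qed.

HB.instance Definition _ f := Order.Le_isPOrder.Build (Order.Disp tt tt) (H f)
  (@le_H_refl f) (@le_H_anti f) (@le_H_trans f).

(* m.+1 - i stands for h_(i-1) - i + 1; the subtraction does not truncate
   because the finite entries of h are strictly increasing, so i - 1 <= m. *)
Definition generators f (h : H f) : set (P f) :=
  [set x | exists i m : nat,
     [/\ (1 <= i)%N, h i.-1 = Fin m, (succ_enat (h i.-1) < h i)%O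
       & x = (m.+1 - i, m.+1)%N :> nat * nat]].

(* Every pair that the formula produces is an element of P f, so that no
   generator is lost in the previous definition. *)
Lemma generators_inP f (h : H f) (i m : nat) :
  (1 <= i)%N -> h i.-1 = Fin m -> (succ_enat (h i.-1) < h i)%O ->
  (i <= m.+1)%N /\ inP f (m.+1 - i, m.+1)%N.
Proof.
case: i => // i _ /= hi; rewrite hi /= => lt_h.
have /asboolP[h0|[k [a [ha a_incr fk fj]]]] := seqP h; first by rewrite h0 in hi.
have le_a n : (n <= k)%N -> (n <= a n)%N.
  elim: n => // n IHn lt_nk.
  exact: leq_ltn_trans (IHn (ltnW lt_nk)) (a_incr n.+1 lt_nk).
move: hi lt_h; rewrite !ha; case: (leqP i k) => // le_ik -[<-] lt_h.
have le_ia := le_a _ le_ik; split=> //; rewrite /inP /= subSS ltnS leq_subr /=.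
move: lt_h; case: (ltnP i k) => [lt_ik lt_a|le_ki _].
  apply: (fj i.+1) => //=; move: lt_a; rewrite lt_neqAle => /andP[ne le].
  by rewrite ltn_neqAle; apply/andP; split=> //; apply: contra ne => /eqP ->.
by have -> : i = k by apply/eqP; rewrite eqn_leq le_ik.
Qed.

Definition ideal_of f (h : H f) : J (P f) := generated_ideal (generators h).

Definition shift f (I : set (P f)) : set (P f) :=
  [set x | exists2 y : P f, I y & x = (y.1.+1, y.2) :> nat * nat].

Definition height f (I : set (P f)) : enat :=
  min_enat [set Fin x.1 | x in I].

Definition kappa f (I : J (P f)) (n : nat) : enat :=
  height (iter n (@shift f) I).

(* Main.v *)
Require Import Defs.
From mathcomp Require Import all_boot all_order boolp classical_sets cardinality.
From mathcomp Require Import zify.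

(** Everything follows from a description of the two maps that does not mention
    generated ideals or iterated shifts.  A point (v, alpha) of P_f lies on the level
    n = alpha - 1 - v, and the order reads (v, alpha) <= (w, beta) if and only
    if w <= v and w + n < beta.

    - An ideal of the form I(h) consists of the points (v, alpha) such that
      h_n <= alpha - 1, that is h_n - n <= v ([mem_ideal_of]).  Indeed h_n - n
      is nondecreasing as long as it is finite, and it is constant from n up to
      the first index j >= n at which h jumps by more than 1; this jump gives
      the generator (h_j - j, h_j + 1).
    - kappa(I)_n is the minimum of w + n over the points (w, beta) of I such
      that w + n < beta ([kappa_le], [kappa_attained]).

    Combining the two, a point (v, alpha) of level n is in I(kappa(I)) if and
    only if there is a point (w, beta) of I with w + n < beta and w <= v, that
    is, if and only if it lies below a point of I, hence is in I.  Conversely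
    kappa(I(h))_n = h_n: the generator at the first jump j >= n gives the
    value h_n, and no point of I(h) gives a smaller one because h_m - m is
    nondecreasing.  Both maps are monotone by the same descriptions.

    That kappa(I) is in H_f comes from the point (w, beta) at which the minimum
    kappa(I)_n is attained: if beta > w + n + 1 then the same point shows that
    kappa(I)_(n+1) <= kappa(I)_n + 1, so before a larger jump
    beta = kappa(I)_n + 1, whence f_(kappa(I)_n + 1) > 0.  The finiteness of
    the support of f makes kappa(I)_n infinite for large n. *)

Set Implicit Arguments.
Unset Strict Implicit.
Unset Printing Implicit Defensive.

Import Order.TTheory.
Local Open Scope classical_set_scope.

(** * Extended natural numbers and their minima *)

Lemma le_FinE (m n : nat) : (Fin m <= Fin n)%O = (m <= n)%N.
Proof. by []. Qed.

Lemma lt_FinE (m n : nat) : (Fin m < Fin n)%O = (m < n)%N.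
Proof. by rewrite ltNge le_FinE -ltnNge. Qed.

Lemma le_enat_FinP (x : enat) (c : nat) :
  (x <= Fin c)%O <-> exists2 b, x = Fin b & (b <= c)%N.
Proof.
case: x => [b|]; split=> //; last by case.
- by exists b.
- by case=> ? [<-].
Qed.

Lemma enat_le_upper (x y : enat) :
  (forall c, (y <= Fin c)%O -> (x <= Fin c)%O) -> (x <= y)%O.
Proof. by case: y => [b|] h; [exact: h | case: x {h}]. Qed.

Lemma min_enat_le (A : set enat) (x : enat) : A x -> (min_enat A <= x)%O.
Proof.
rewrite /min_enat => Ax; case: xgetP => [y _ [_ lby]|noA]; first exact: lby.
(* A nonempty set has a minimum: its least finite element if there is one. *)
have [[n An]|nofin] := pselect (exists n, A (Fin n)).
  have exA : exists n, `[< A (Fin n) >] by exists n; apply/asboolP.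
  case: (ex_minnP exA) => m /asboolP Am minm.
  case: (noA (Fin m)); split=> // -[p|] Ap //.
  by rewrite le_FinE; apply/minm/asboolP.
case: x Ax => [n An|A_oo]; first by case: nofin; exists n.
by case: (noA Infty); split=> // -[p|] // Ap; case: nofin; exists p.
Qed.

Lemma min_enat_in (A : set enat) (c : nat) : min_enat A = Fin c -> A (Fin c).
Proof. by rewrite /min_enat; case: xgetP => // x -> [Ax _] <-. Qed.

(** * The posets P_f, J(P_f) and H_f *)

Section Correspondence.
Variable f : nat -> nat.
Implicit Types (h : H f) (I : J (P f)) (x y : P f).

Lemma P_bound x : (x.1 < x.2)%N.
Proof. by case/and3P: (pairP x). Qed.

Lemma P_mult_gt0 x : (0 < f x.2)%N.
Proof. by case/and3P: (pairP x). Qed.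

Lemma le_PE x y : (x <= y)%O = (y.1 <= x.1)%N && (x.2 - x.1 <= y.2 - y.1)%N.
Proof. by []. Qed.

Lemma le_JP (I I' : J (P f)) : (I <= I')%O <-> (I : set (P f)) `<=` I'.
Proof. by rewrite -Order.le_val; split=> /subsetPset. Qed.

Lemma le_HP (h h' : H f) : (h <= h')%O <-> forall n, (h' n <= h n)%O.
Proof. by split=> /asboolP. Qed.

(** The finite part of h is an initial segment on which h_n - n is
    nondecreasing. *)
Lemma H_slope h (n m b : nat) : (n <= m)%N -> h m = Fin b ->
  exists2 a, h n = Fin a & (a + m <= b + n)%N.
Proof.
have /asboolP[h0|[k [a [ha a_incr _ _]]]] := seqP h; first by rewrite h0.
elim: m b => [|m IHm] b.
  by rewrite leqn0 => /eqP -> ->; exists b.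
rewrite leq_eqVlt => /predU1P[-> -> | le_nm]; first by exists b.
rewrite ha; case: leqP => // lt_mk [<-].
have hm : h m = Fin (a m) by rewrite ha (ltnW lt_mk).
have [c hn le_c] := IHm _ le_nm hm.
by exists c => //; have := a_incr m.+1 lt_mk; rewrite /=; lia.
Qed.

Lemma H_ge h (n c : nat) : h n = Fin c -> (n <= c)%N.
Proof. by move=> hn; have [a _] := H_slope (leq0n n) hn; lia. Qed.

(** From any index n with h_n finite, h increases by steps of 1 until some
    index j, where it jumps. *)
Lemma H_jump h (n c : nat) : h n = Fin c ->
  exists j b, [/\ (n <= j)%N, h j = Fin b, (b + n = c + j)%N
                & (succ_enat (h j) < h j.+1)%O].
Proof.
have [k hk] : exists k, forall m, (k < m)%N -> h m = Infty.
  have /asboolP[h0|[k [a [ha _ _ _]]]] := seqP h; first by exists 0.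
  by exists k => m lt_km; rewrite ha leqNgt lt_km.
have [d] := ubnP (k.+1 - n); elim: d n c => // d IHd n c lt_d hn.
have le_nk : (n <= k)%N by rewrite leqNgt; apply/negP => /hk; rewrite hn.
have [jump|] := boolP (succ_enat (h n) < h n.+1)%O; first by exists n, c.
rewrite -leNgt hn => /le_enat_FinP[c' hn1 le_c'].
have [a] := H_slope (leqnSn n) hn1; rewrite hn => -[<-] lt_c.
have [|j [b [le_nj hj eq_b jump]]] := IHd n.+1 c' _ hn1; first by lia.
by exists j, b; split=> //; lia.
Qed.

(** * The ideal of a sequence *)

(** A point (v, alpha) is in I(h) if and only if
    h_(alpha - 1 - v) <= alpha - 1. *)
Lemma mem_ideal_of h x :
  (ideal_of h : set (P f)) x <-> (h (x.2.-1 - x.1) <= Fin x.2.-1)%O.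
Proof.
have ltx := P_bound x; split.
  case=> y [[i [m [i_gt0 hi _ eq_y]]]].
  rewrite le_PE eq_y => /andP[/= le_v le_d].
  have le_im := H_ge hi.
  have [|a ha le_a] := H_slope (n := x.2.-1 - x.1) _ hi; first by lia.
  by apply/le_enat_FinP; exists a => //; lia.
case/le_enat_FinP=> c hc le_c.
have [j [b [le_nj hj eq_b jump]]] := H_jump hc.
have [_ yP] := @generators_inP f h j.+1 b isT hj jump.
exists (MkP yP); split; first by exists j.+1, b.
by have le_jb := H_ge hj; rewrite le_PE; apply/andP; split=> /=; lia.
Qed.

(** * The sequence of an ideal *)

Lemma mem_iter_shift (A : set (P f)) (n : nat) x :
  iter n (@shift f) A x <->
  exists2 y, A y & (x = (y.1 + n, y.2) :> nat * nat)%N.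
Proof.
elim: n x => [|n IHn] x /=.
  split=> [Ax|[y Ay]]; first by exists x => //; rewrite addn0; case: (pair_of x).
  rewrite addn0 => eq_xy; suff -> : x = y by [].
  by apply: val_inj; rewrite /= eq_xy; case: (pair_of y).
split.
  by case=> z /IHn[y Ay eq_z] ->; exists y => //; rewrite eq_z /= addnS.
case=> y Ay eq_x; have /and3P[] := pairP x; rewrite eq_x /= => y2 ltx fy.
have zP : inP f (y.1 + n, y.2)%N by apply/and3P; split=> //=; lia.
exists (MkP zP); first by apply/IHn; exists y.
by rewrite eq_x /= addnS.
Qed.

Lemma kappa_attained I (n c : nat) : kappa I n = Fin c ->
  exists y, [/\ (I : set (P f)) y, (y.1 + n = c)%N & (c < y.2)%N].
Proof.
move=> /min_enat_in[x /mem_iter_shift[y Iy eq_x] [<-]]; exists y; split=> //.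
  by rewrite eq_x.
by have := P_bound x; rewrite eq_x.
Qed.

Lemma kappa_le_point I y (n : nat) : (I : set (P f)) y -> (y.1 + n < y.2)%N ->
  (kappa I n <= Fin (y.1 + n))%O.
Proof.
move=> Iy lty; have xP : inP f (y.1 + n, y.2)%N.
  by apply/and3P; split=> //=; [lia | exact: P_mult_gt0].
by apply: min_enat_le; exists (MkP xP) => //; apply/mem_iter_shift; exists y.
Qed.

(** kappa(I)_n is the minimum of w + n over the points (w, beta) of I such that
    w + n < beta, expressed through its finite upper bounds. *)
Lemma kappa_le I (n c : nat) : (kappa I n <= Fin c)%O <->
  exists y, [/\ (I : set (P f)) y, (y.1 + n <= c)%N & (y.1 + n < y.2)%N].
Proof.
split=> [/le_enat_FinP[b /kappa_attained[y [Iy <- lty]] le_b]|].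
  by exists y.
by case=> y [Iy le_c /(kappa_le_point Iy) le_y]; apply: le_trans le_y _.
Qed.

Lemma mem_kappa I x :
  (I : set (P f)) x <-> (kappa I (x.2.-1 - x.1) <= Fin x.2.-1)%O.
Proof.
have ltx := P_bound x; split=> [Ix|/kappa_le[y [Iy le_y lt_y]]].
  by apply/kappa_le; exists x; split=> //; lia.
have /asboolP downI := idealP I.
by apply: downI Iy; rewrite le_PE; apply/andP; split; lia.
Qed.

Lemma kappa_anti (I I' : J (P f)) (n : nat) :
  (I : set (P f)) `<=` I' -> (kappa I' n <= kappa I n)%O.
Proof.
move=> sII'; apply: enat_le_upper => c /kappa_le[y [Iy le_y lt_y]].
by apply/kappa_le; exists y; split=> //; apply: sII'.
Qed.

Lemma kappa_ideal_of h (n : nat) : kappa (ideal_of h) n = h n.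
Proof.
apply: le_anti; apply/andP; split; apply: enat_le_upper => c.
  case/le_enat_FinP=> b hn le_b.
  have [j [d [le_nj hj eq_d jump]]] := H_jump hn; have le_jd := H_ge hj.
  have [_ yP] := @generators_inP f h j.+1 d isT hj jump.
  apply/kappa_le; exists (MkP yP); split=> /=; try lia.
  by exists (MkP yP); split; [exists j.+1, d | exact: lexx].
case/kappa_le=> y [/mem_ideal_of/le_enat_FinP[b hm le_b] le_c lty].
have [|a hn le_a] := H_slope (n := n) _ hm; first by lia.
by apply/le_enat_FinP; exists a => //; lia.
Qed.

(** * The sequence of an ideal belongs to H_f *)

Lemma kappaS I (n c : nat) : kappa I n.+1 = Fin c ->
  exists2 b, kappa I n = Fin b & (b < c)%N.
Proof.
case/kappa_attained=> y [Iy eq_c lty].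
have [|b kb le_b] := (le_enat_FinP (kappa I n) c.-1).1; last first.
  by exists b => //; lia.
by apply/kappa_le; exists y; split=> //; lia.
Qed.

(** The point at which kappa(I)_n is attained does not count for n + 1, which
    determines its second coordinate. *)
Lemma kappa_jump I (n c : nat) : kappa I n = Fin c ->
  (Fin c.+1 < kappa I n.+1)%O -> (0 < f c.+1)%N.
Proof.
case/kappa_attained=> y [Iy eq_c lty] jump.
suff <- : y.2 = c.+1 by apply: P_mult_gt0.
apply/eqP; rewrite eqn_leq lty andbT leqNgt; apply/negP => lt_c.
by move: jump; rewrite ltNge -eq_c -addnS kappa_le_point //; lia.
Qed.

Lemma kappa_inH I :
  finite_set [set a : nat | (1 <= a)%N && (0 < f a)%N] -> inH f (kappa I).
Proof.
move=> f_finite.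
have [N leN] : exists N, forall a, (0 < a)%N && (0 < f a)%N -> (a <= N)%N.
  have [s eq_s] := (finite_seqP _).1 f_finite.
  exists (\max_(a <- s) a)%N => a Ha.
  have /= as_ : [set` s] a by rewrite -eq_s.
  exact: leq_bigmax_seq.
(* kappa(I)_N = w + N < beta would contradict beta <= N. *)
have kN : kappa I N = Infty.
  case E: (kappa I N) => [c|] //; have [y [_ eq_c lty]] := kappa_attained E.
  by have := leN y.2; rewrite P_mult_gt0; lia.
have ex_oo : exists n, kappa I n == Infty by exists N; apply/eqP.
case: (ex_minnP ex_oo) => m /eqP km minm.
have koo n : (m <= n)%N -> kappa I n = Infty.
  move/subnK <-; elim: (n - m)%N => // d IHd.
  by case E: (kappa I (d.+1 + m)) => [c|] //; have [b] := kappaS E; rewrite IHd.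
case: m => [|k] in km minm koo; first by left=> n; apply: koo.
right; pose a n := if kappa I n is Fin c then c else 0.
have ka n : (n <= k)%N -> kappa I n = Fin (a n).
  rewrite /a; case E: (kappa I n) => [c|] // le_nk.
  by have := minm n; rewrite E eqxx ltnNge le_nk => /(_ isT).
exists k, a; split.
- by move=> n; case: leqP => [/ka|/koo].
- move=> [|n] //= /ka kn; have [b kb lt_b] := kappaS kn.
  by rewrite {1}/a kb.
- by apply: (@kappa_jump I k); rewrite ?km ?ka.
- move=> [|n] //= lt_nk jump.
  by apply: (@kappa_jump I n); rewrite ka ?lt_FinE // ltnW.
Qed.

End Correspondence.

(** * The isomorphism *)

Theorem theorem21 (f : nat -> nat)
    (f_finite : finite_set [set a : nat | (1 <= a)%N && (0 < f a)%N]) :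
  exists K : J (P f) -> H f,
    [/\ forall (I : J (P f)) (n : nat), K I n = kappa I n,
        cancel (@ideal_of f) K,
        cancel K (@ideal_of f),
        {homo @ideal_of f : h h' / (h <= h')%O}
      & {homo K : I I' / (I <= I')%O}].
Proof.
exists (fun I => MkH (introT (asboolP _) (kappa_inH I f_finite))); split=> //.
- by move=> h; apply: val_inj; apply/funext => n /=; exact: kappa_ideal_of.
- move=> I; apply: val_inj; apply/seteqP; split=> x.
    by move/(mem_ideal_of _ x).1/mem_kappa.
  by move/mem_kappa => Ix; apply: (mem_ideal_of _ x).2.
- move=> h h' /le_HP le_hh'; apply/le_JP => x /mem_ideal_of hx.
  by apply/mem_ideal_of; apply: le_trans hx; apply: le_hh'.
- by move=> I I' /le_JP sII'; apply/le_HP => n; apply: kappa_anti.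
Qed.
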